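(* For every prime $p\equiv 1\pmod 4$, every $M\in SO(3)_p$ can be written as $M=R_xR_zR_y$ with $R_x\in G_x$, $R_y\in G_y$, $R_z\in G_z$, and also as $M=R'_yR'_zR'_x$ with $R'_x\in G_x$, $R'_y\in G_y$, $R'_z\in G_z$.
   Context: Let $p\equiv 1\pmod 4$ be prime, fix a unit $u\in\mathbb{Z}_p^\times$ that is not a square in $\mathbb{Q}_p$, and set $v=-u$. Let $Q_+(\mathbf{x})=x_1^2-vx_2^2+px_3^2$ with matrix $A=\mathrm{diag}(1,-v,p)$, and $SO(3)_p=\{L\in M_{3\times 3}(\mathbb{Q}_p): L^\top A L=A,\ \det L=1\}$. With $\mathbf{e}_1,\mathbf{e}_2,\mathbf{e}_3$ the canonical basis, let $G_x=\{L\in SO(3)_p:L\mathbf{e}_1=\mathbf{e}_1\}$, $G_y=\{L\in SO(3)_p:L\mathbf{e}_2=\mathbf{e}_2\}$, $G_z=\{L\in SO(3)_p:L\mathbf{e}_3=\mathbf{e}_3\}$. *)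

(* Defs.v *)
From HB Require Import structures.
From mathcomp Require Import all_boot all_order all_algebra.
From mathcomp Require Import boolp.

Set Implicit Arguments.
Unset Strict Implicit.
Unset Printing Implicit Defensive.

Import Order.TTheory GRing.Theory Num.Theory.
Local Open Scope ring_scope.

(* Z_p as the inverse limit of the Z/p^n: an element x is given by its residues
   x n modulo p^n. The single equation below says both that x n is the reduced
   representative (0 <= x n < p^n) and that x n.+1 lifts x n. The primality
   proof is a parameter of the type so that the integral domain structure can
   be inferred from the type alone. *)
Record padic_int (p : nat) (p_pr : prime p) := PadicInt {
  residue :> nat -> int;
  residueP : forall n, residue n = (residue n.+1 %% (p ^ n)%N)%Z
}.

Lemma modz_dvd (a d q : int) : (q %| d)%Z -> ((a %% d)%Z = a %[mod q])%Z.
Proof.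
move=> /dvdzP [k dE]; rewrite [in RHS](divz_eq a d) [in X in _ * X]dE mulrA.
by rewrite modzMDl.
Qed.

Section PadicInt.
Context (p : nat) (p_pr : prime p).
Local Notation Zp := (padic_int p_pr).
Local Notation pn n := (Posz (p ^ n)%N).

HB.instance Definition _ := gen_eqMixin Zp.
HB.instance Definition _ := gen_choiceMixin Zp.

Lemma padic_intP (x y : Zp) : (forall n, x n = y n) -> x = y.
Proof.
case: x y => [x hx] [y hy] /= xy.
have {}xy : x = y by apply: funext.
by subst y; congr PadicInt; apply: Prop_irrelevance.
Qed.

Lemma residue_mod (x : Zp) n : (x n %% pn n)%Z = x n.
Proof. by rewrite residueP modz_mod. Qed.

Lemma dvdz_pn m n : (pn n %| pn (n + m)%N)%Z.
Proof. by rewrite expnD PoszM dvdz_mulr. Qed.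

Lemma residue_add n m (x : Zp) : (x (n + m)%N %% pn n)%Z = x n.
Proof.
elim: m => [|m IHm]; first by rewrite addn0 residue_mod.
by rewrite addnS -IHm (residueP x (n + m)) modz_dvd // dvdz_pn.
Qed.

Lemma padic_mk_subproof (f : nat -> int) :
    (forall n, f n.+1 = f n %[mod pn n])%Z ->
  forall n, (f n %% pn n)%Z = ((f n.+1 %% pn n.+1)%Z %% pn n)%Z.
Proof. by move=> fP n; rewrite modz_dvd ?fP // -addn1 dvdz_pn. Qed.

Definition padic_mk f fP : Zp :=
  @PadicInt p p_pr (fun n => f n %% pn n)%Z (padic_mk_subproof fP).

Lemma residue_coh (x : Zp) n : (x n.+1 = x n %[mod pn n])%Z.
Proof. by rewrite residue_mod -residueP. Qed.

Lemma padic_cst_subproof (a : int) n : (a = a %[mod pn n])%Z.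
Proof. by []. Qed.

Lemma padic_opp_subproof (x : Zp) n : (- x n.+1 = - x n %[mod pn n])%Z.
Proof. by rewrite -modzNm residue_coh modzNm. Qed.

Lemma padic_add_subproof (x y : Zp) n :
  (x n.+1 + y n.+1 = x n + y n %[mod pn n])%Z.
Proof. by rewrite -modzDm !residue_coh modzDm. Qed.

Lemma padic_mul_subproof (x y : Zp) n :
  (x n.+1 * y n.+1 = x n * y n %[mod pn n])%Z.
Proof. by rewrite -modzMm !residue_coh modzMm. Qed.

Definition padic_cst a := padic_mk (padic_cst_subproof a).
Definition padic_opp x := padic_mk (padic_opp_subproof x).
Definition padic_add x y := padic_mk (padic_add_subproof x y).
Definition padic_mul x y := padic_mk (padic_mul_subproof x y).

Fact padic_addA : associative padic_add.
Proof. by move=> x y z; apply: padic_intP => n /=; rewrite modzDml modzDmr addrA. Qed.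
Fact padic_addC : commutative padic_add.
Proof. by move=> x y; apply: padic_intP => n /=; rewrite addrC. Qed.
Fact padic_add0 : left_id (padic_cst 0) padic_add.
Proof. by move=> x; apply: padic_intP => n /=; rewrite modzDml add0r residue_mod. Qed.
Fact padic_addN : left_inverse (padic_cst 0) padic_opp padic_add.
Proof. by move=> x; apply: padic_intP => n /=; rewrite modzDml addNr. Qed.

HB.instance Definition _ :=
  GRing.isZmodule.Build Zp padic_addA padic_addC padic_add0 padic_addN.

Fact padic_mulA : associative padic_mul.
Proof. by move=> x y z; apply: padic_intP => n /=; rewrite modzMml modzMmr mulrA. Qed.
Fact padic_mulC : commutative padic_mul.
Proof. by move=> x y; apply: padic_intP => n /=; rewrite mulrC. Qed.
Fact padic_mul1 : left_id (padic_cst 1) padic_mul.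
Proof. by move=> x; apply: padic_intP => n /=; rewrite modzMml mul1r residue_mod. Qed.
Fact padic_mulDl : left_distributive padic_mul +%R.
Proof. by move=> x y z; apply: padic_intP => n /=; rewrite modzMml modzDm mulrDl. Qed.
Fact padic_1neq0 : padic_cst 1 != 0.
Proof.
apply/eqP => /(congr1 (fun x : Zp => x 1%N)) /=.
rewrite mod0z expn1 modz_nat modn_small ?prime_gt1 //.
Qed.

HB.instance Definition _ := GRing.Zmodule_isComNzRing.Build Zp
  padic_mulA padic_mulC padic_mul1 padic_mulDl padic_1neq0.

(* Invertibility in Z_p is not decidable: the unit ring structure is classical. *)
Definition padic_unit : {pred Zp} := fun x => `[< exists y, y * x = 1 >].

Definition padic_inv (x : Zp) : Zp :=
  if pselect (exists y, y * x = 1) is left ex then projT1 (cid ex) else x.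

Fact padic_mulV : {in padic_unit, left_inverse 1 padic_inv *%R}.
Proof.
by move=> x /asboolP xu; rewrite /padic_inv; case: pselect => // ?; case: cid.
Qed.
Fact padic_unitPl x y : y * x = 1 -> padic_unit x.
Proof. by move=> yx; apply/asboolP; exists y. Qed.
Fact padic_inv_out : {in [predC padic_unit], padic_inv =1 id}.
Proof.
by move=> x /asboolP xNu; rewrite /padic_inv; case: pselect.
Qed.

HB.instance Definition _ := GRing.ComNzRing_hasMulInverse.Build Zp
  padic_mulV padic_unitPl padic_inv_out.

Lemma residueM (x y : Zp) n : (x * y) n = (x n * y n %% pn n)%Z.
Proof. by []. Qed.

Lemma residue0 n : (0 : Zp) n = 0.
Proof. exact: mod0z. Qed.

Lemma padic_neq0 (x : Zp) : x != 0 -> exists n, forall m, ~~ (pn n %| x (n + m)%N)%Z.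
Proof.
move=> x0; have /existsNP [n xn] : ~ forall n, x n = (0 : Zp) n.
  by move=> h; move/eqP: x0; apply; apply: padic_intP.
exists n => m; apply/negP => /dvdz_mod0P h.
by apply: xn; rewrite residue0 -(residue_add n m x).
Qed.

Fact padic_idomain : GRing.integral_domain_axiom Zp.
Proof.
move=> x y xy0; apply/norP => -[/padic_neq0 [i xi] /padic_neq0 [j yj]].
have := congr1 (fun z : Zp => z (i + j)%N) xy0.
rewrite residueM residue0 => /dvdz_mod0P; move: (xi j) (yj i).
rewrite [(j + i)%N]addnC !dvdzE abszM /=.
set a := absz _; set b := absz _ => ha hb hab.
have a0 : (0 < a)%N by case: a ha {hab} => //; rewrite dvdn0.
have b0 : (0 < b)%N by case: b hb {hab} => //; rewrite dvdn0.
move: ha hb hab; rewrite !pfactor_dvdn ?muln_gt0 ?a0 // lognM // -!ltnNge.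
by move=> ha hb; rewrite leqNgt -addSn leq_add // ltnW.
Qed.

HB.instance Definition _ :=
  GRing.ComUnitRing_isIntegral.Build Zp padic_idomain.
End PadicInt.

(* Q_p is the fraction field of Z_p; u%:F is the image of u : Z_p in Q_p. *)
Notation padic p_pr := {fraction (padic_int p_pr)}.
Notation "x %:F" := (FracField.tofrac x) : ring_scope.

Section SpecialOrthogonal.
Context (p : nat) (p_pr : prime p).
Local Notation Qp := (padic p_pr).
Implicit Types (v : Qp) (L : 'M[Qp]_3).

Definition Qplus v (x : 'cV[Qp]_3) : Qp :=
  x 0 0 ^+ 2 - v * x 1 0 ^+ 2 + p%:R * x 2 0 ^+ 2.

Definition Qplus_mx v : 'M[Qp]_3 :=
  diag_mx (\row_(j < 3) [:: 1; - v; p%:R]`_j).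

Lemma Qplus_mxE v x : (x^T *m Qplus_mx v *m x) 0 0 = Qplus v x.
Proof.
rewrite /Qplus mul_mx_diag !mxE !big_ord_recl big_ord0 !mxE /=.
have -> : lift ord0 (ord0 : 'I_2) = 1 by apply: val_inj.
have -> : lift ord0 (lift ord0 (ord0 : 'I_1)) = 2 by apply: val_inj.
by rewrite addr0 mulr1 !expr2 addrA mulrN mulNr -!mulrA ![x _ _ * (_ * _)]mulrCA.
Qed.

Definition SO3 v L : Prop :=
  L^T *m Qplus_mx v *m L = Qplus_mx v /\ \det L = 1.

Definition stab v (i : 'I_3) L : Prop :=
  SO3 v L /\ L *m delta_mx i 0 = delta_mx i 0 :> 'cV[Qp]_3.

(* Coordinates are numbered from 0, so e_1, e_2, e_3 are delta_mx i 0, i < 3. *)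
Definition G_x v L := stab v 0 L.
Definition G_y v L := stab v 1 L.
Definition G_z v L := stab v 2 L.
End SpecialOrthogonal.

(* Main.v *)
Require Import Defs.
From mathcomp Require Import all_boot all_order all_algebra.
From mathcomp Require Import ring.

Set Implicit Arguments.
Unset Strict Implicit.
Unset Printing Implicit Defensive.

Import GRing.Theory.
Local Open Scope ring_scope.

(** The decomposition M = R_x R_z R_y amounts to finding R_x and R_z with
    R_x R_z e_2 = M e_2 =: (x, y, z). The rotations in G_z act transitively on
    the vectors (x, t, 0) of norm u, and those in G_x preserve x, so what is
    needed is some t with u y^2 + p z^2 = u t^2, i.e., u - x^2 must be u times a
    square. By Hensel's lemma, u y^2 + p z^2 is u times a square if y divides z
    in Z_p, and p times a square otherwise. The latter is impossible because
    u - x^2 = p w^2 has no solution in Q_p for a nonsquare unit u. The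
    decomposition M = R_y R_z R_x is the inverse of the first one for M^-1. *)

(** * Arithmetic of Z_p: congruences, divisibility, square roots and the ternary form *)

Section PadicIntegers.
Context {p : nat} {p_pr : prime p}.
Local Notation Zp := (padic_int p_pr).
Local Notation pn n := (Posz (p ^ n)%N).
Implicit Types (x y z : Zp) (n : nat).

Lemma residueD x y n : (x + y) n = ((x n + y n) %% pn n)%Z.
Proof. by []. Qed.

Lemma residueN x n : (- x) n = ((- x n) %% pn n)%Z.
Proof. by []. Qed.

Lemma residue1 n : (1 : Zp) n = (1 %% pn n)%Z.
Proof. by []. Qed.

Lemma residue_nat k n : (k%:R : Zp) n = (k %% pn n)%Z.
Proof.
elim: k => [|k IHk]; first by rewrite residue0 mod0z.
by rewrite -natr1 residueD IHk residue1 modzDm -addn1 PoszD.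
Qed.

Lemma residueD_eq0 x y n : x n = 0 -> y n = 0 -> (x + y) n = 0.
Proof. by rewrite residueD => -> ->; rewrite mod0z. Qed.

Lemma residueN_eq0 x n : x n = 0 -> (- x) n = 0.
Proof. by rewrite residueN => ->; rewrite mod0z. Qed.

Lemma residueMr_eq0 x y n : x n = 0 -> (x * y) n = 0.
Proof. by rewrite residueM => ->; rewrite mul0r mod0z. Qed.

Lemma residueB_eq0 x y n : (x - y) n = 0 <-> x n = y n.
Proof.
rewrite residueD residueN modzDmr -(residue_mod x) -(residue_mod y).
split=> [/dvdz_mod0P|/eqP]; last first.
  by rewrite eqz_mod_dvd => /dvdz_mod0P; rewrite !residue_mod.
by rewrite !residue_mod -eqz_mod_dvd => /eqP; rewrite !residue_mod.
Qed.

(** Valuations add: [x n = 0] says that p^n divides [x]. *)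
Lemma residueM_eq0 x y m n : x m = 0 -> y n = 0 -> (x * y) (m + n)%N = 0.
Proof.
rewrite -{1}(residue_add m n x) -{1}(residue_add n m y) [(n + m)%N]addnC.
move=> /dvdz_mod0P xm /dvdz_mod0P yn; rewrite residueM; apply/dvdz_mod0P.
by rewrite expnD PoszM dvdz_mul.
Qed.

Lemma residue1_natrp : (p%:R : Zp) 1%N = 0.
Proof. by rewrite residue_nat expn1 modzz. Qed.

Lemma natrp_neq0 : p%:R != 0 :> Zp.
Proof.
apply/eqP => /(congr1 (fun x : Zp => x 2)); rewrite residue_nat residue0.
rewrite modz_nat modn_small; last first.
  by rewrite -[X in (X < _)%N]expn1 ltn_exp2l ?prime_gt1.
by move/eqP; rewrite eqz_nat -leqn0 leqNgt prime_gt0.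
Qed.

(** Division by p costs one digit: the quotient modulo p^n is read off [x n.+1]. *)
Lemma residue1_eq0_dvd x : x 1%N = 0 -> exists y, x = p%:R * y.
Proof.
move=> x1.
have pdx n : (p %| x n.+1)%Z.
  by apply/dvdz_mod0P; have := residue_add 1 n x; rewrite x1 expn1 add1n.
have pn0 : Posz p != 0 by rewrite eqz_nat -lt0n prime_gt0.
have yP n : (divz (x n.+2) p = divz (x n.+1) p %[mod pn n])%Z.
  apply/eqP; rewrite eqz_mod_dvd -(dvdz_mul2l pn0) -PoszM -expnS mulrBr.
  rewrite ![p%:Z * _]mulrC !divzK // -eqz_mod_dvd.
  by apply/eqP; exact: residue_coh.
exists (padic_mk _ yP); apply: padic_intP => n.
rewrite residueM residue_nat modzMml /= modzMmr mulrC divzK //.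
by rewrite residue_coh residue_mod.
Qed.

(** Completeness of Z_p: the diagonal residues [r n n] form a coherent family. *)
Lemma padic_limit (r : nat -> Zp) :
  (forall n, r n.+1 n = r n n) -> exists x, forall n, x n = r n n.
Proof.
move=> rP.
have rP' n : (r n.+1 n.+1 = r n n %[mod pn n])%Z.
  by have := residue_add n 1 (r n.+1); rewrite addn1 residue_mod rP.
by exists (padic_mk _ rP') => n /=; rewrite residue_mod.
Qed.

(* Every approximate inverse [b] of [x] is corrected by the geometric series
   of [1 - x * b]. *)
Lemma residue1_neq0_unit x : x 1%N != 0 -> x \is a GRing.unit.
Proof.
move=> x1.
have [b xb] : exists b : Zp, (1 - x * b) 1%N = 0.
  have : coprimez (x 1%N) p.
    rewrite coprimez_sym coprimezE prime_coprime //; apply: contra x1 => px.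
    by rewrite -(residue_mod x) expn1; apply/eqP/dvdz_mod0P.
  case/coprimezP => -[s t] st; rewrite /= in st.
  exists (padic_cst p_pr s). apply/residueB_eq0.
  rewrite residueM residue1 /= expn1 modzMmr -st addrC.
  by rewrite modzMDl mulrC.
set e := 1 - x * b in xb.
have eX n : (e ^+ n) n = 0.
  elim: n => [|n IHn]; first by rewrite residue1 modz1.
  by rewrite exprS -add1n residueM_eq0.
have [n|y yP] := @padic_limit (fun n => \sum_(i < n) e ^+ i).
  by apply/residueB_eq0; rewrite big_ord_recr addrAC subrr add0r; exact: eX.
apply/unitrPr; exists (b * y); apply: padic_intP => n; apply/esym/residueB_eq0.
(* As x b = 1 - e and 1 - e times the partial sum is 1 - e^n, the error splits into e^n and a
   multiple of the difference between the partial sum and its limit [y]; both vanish modulo p^n. *)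
have -> : 1 - x * (b * y) = e ^+ n + (1 - e) * ((\sum_(i < n) e ^+ i) - y).
  have := subrX1 e n; rewrite /e => E.
  rewrite mulrBr -[in X in _ = _ + (X - _)]opprB mulNr -E.
  by ring.
apply: residueD_eq0; rewrite ?eX // mulrC; apply: residueMr_eq0.
by apply/residueB_eq0; rewrite yP.
Qed.

Lemma unit_residue1 x : x \is a GRing.unit -> x 1%N != 0.
Proof.
move=> xu; apply/eqP => x1.
have : (x * x^-1) 1%N = 0 by apply: residueMr_eq0.
by rewrite divrr // residue1 expn1 modz_nat modn_small ?prime_gt1.
Qed.

Lemma padic_unit_or_dvd x : x \is a GRing.unit \/ exists y, x = p%:R * y.
Proof.
have [x1|x1] := eqVneq (x 1%N) 0; first by right; apply: residue1_eq0_dvd.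
by left; apply: residue1_neq0_unit.
Qed.

Lemma padic_neq0_residue x : x != 0 -> exists n, x n != 0.
Proof.
case/padic_neq0 => n /(_ 0%N); rewrite addn0 => xn.
by exists n; apply: contraNneq xn => ->.
Qed.

(** Z_p is a valuation ring: common factors p are removed until [x] or [y] is a unit, and the
    nonzero residue [x n] bounds the number of rounds. The factor p in the second case records that
    [x] has strictly larger valuation. *)
Lemma padic_dvd_total x y :
  x != 0 -> (exists z, y = x * z) \/ (exists z, x = p%:R * y * z).
Proof.
case/padic_neq0_residue => n; elim: n x y => [|n IHn] x y xn.
  by rewrite -(residue_mod x) modz1 in xn.
case: (padic_unit_or_dvd x) => [xu|[x' xE]].
  by left; exists (x^-1 * y); rewrite mulVKr.
case: (padic_unit_or_dvd y) => [yu|[y' yE]].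
  by right; exists (y^-1 * x'); rewrite -mulrA mulVKr.
have x'n : x' n != 0.
  apply: contraNneq xn => x'n; rewrite xE -add1n residueM_eq0 //.
  exact: residue1_natrp.
case: (IHn _ y' x'n) => [[z zE]|[z zE]]; [left|right]; exists z.
  by rewrite yE zE xE mulrA.
by rewrite xE zE yE !mulrA.
Qed.

(** Newton iteration from 1 for r^2 = c, with the derivative 2 r frozen at 2, a unit because p is
    odd. The iterates stay congruent to 1 modulo p, so each round gains a digit. *)
Lemma padic_sqrt1Dp x :
  odd p -> exists y, y \is a GRing.unit /\ y ^+ 2 = 1 + p%:R * x.
Proof.
move=> p_odd; set c : Zp := 1 + _.
have two_unit : (2%:R : Zp) \is a GRing.unit.
  apply: residue1_neq0_unit; rewrite residue_nat expn1 modz_nat modn_small //.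
  by case: p p_odd (prime_gt1 p_pr) => [|[|[|]]].
set h := (2%:R : Zp)^-1.
pose newton (r : Zp) : Zp := r - (r ^+ 2 - c) * h.
pose r n : Zp := iter n newton 1.
have rP n : (r n - 1) 1%N = 0 /\ (r n ^+ 2 - c) n.+1 = 0.
  elim: n => [|n [IH1 IHn]].
    split; first by rewrite subrr residue0.
    have -> : r 0%N ^+ 2 - c = p%:R * - x by rewrite /r /= /c; ring.
    exact/residueMr_eq0/residue1_natrp.
  have IH1' : (r n ^+ 2 - c) 1%N = 0.
    by rewrite -(residue_add 1 n) add1n IHn mod0z.
  rewrite /r iterS -/(r n) /newton; split.
    rewrite addrAC; apply: residueD_eq0 => //.
    exact/residueN_eq0/residueMr_eq0.
  set s := r n in IH1 IHn IH1' *.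
  (* The first factor vanishes modulo p^(n+1) and the second modulo p. *)
  have -> : (s - (s ^+ 2 - c) * h) ^+ 2 - c
      = (s ^+ 2 - c) * ((s ^+ 2 - c) * (h * h) - (s - 1)).
    have h2 : 2%:R * h = 1 by rewrite divrr.
    (* With 2 h left as a product, this is a polynomial identity in s, c and h. *)
    suff : (s - (s ^+ 2 - c) * h) ^+ 2 - c
       = (s ^+ 2 - c) * ((s ^+ 2 - c) * (h * h) - (s * (2%:R * h) - 1)).
      by rewrite h2 mulr1.
    by ring.
  rewrite -[n.+2]addn1. apply: (@residueM_eq0 _ _ n.+1 1) => //.
  by apply: residueD_eq0; [exact: residueMr_eq0 | exact: residueN_eq0].
have [n|y yP] := @padic_limit r.
  apply/residueB_eq0; rewrite /r iterS -/(r n) /newton addrAC subrr add0r.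
  apply/residueN_eq0/residueMr_eq0.
  by have [_] := rP n; rewrite -(residue_add n 1) addn1 => ->; rewrite mod0z.
exists y; split.
  apply: residue1_neq0_unit; rewrite yP.
  have [/residueB_eq0 -> _] := rP 1%N.
  exact/unit_residue1/unitr1.
apply: padic_intP => n; rewrite expr2 residueM yP -residueM -expr2.
apply/residueB_eq0.
by have [_] := rP n; rewrite -(residue_add n 1) addn1 => ->; rewrite mod0z.
Qed.

(** Descent on [d], bounded by a nonzero residue [d n]. If d is a unit, then so is x / d, and u is
    (x / d)^2 times an element of 1 + p Z_p, hence a square. If p divides d, it divides x and then
    w, and the equation can be divided by p^2. *)
Lemma padic_anisotropic (u d x w : Zp) :
    odd p -> u \is a GRing.unit -> ~ (exists z, z ^+ 2 = u) ->
  u * d ^+ 2 = x ^+ 2 + p%:R * w ^+ 2 -> d = 0.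
Proof.
move=> p_odd uu uNsq; apply: contra_eq => /padic_neq0_residue [n].
have p0 := natrp_neq0.
have sqr_dvd (y z : Zp) : y ^+ 2 = p%:R * z -> exists t, y = p%:R * t.
  move=> yz; case: (padic_unit_or_dvd y) => // yu.
  have := unit_residue1 (unitrX 2 yu).
  by rewrite yz residueMr_eq0 ?residue1_natrp ?eqxx.
elim: n d x w => [|n IHn] d x w dn.
  by rewrite -(residue_mod d) modz1 in dn.
apply/eqP => E.
have [du|[d' dE]] := padic_unit_or_dvd d.
  have uE : u = (x / d) ^+ 2 + p%:R * (w / d) ^+ 2.
    apply: (mulIr (unitrX 2 du)).
    by rewrite E mulrDl -[p%:R * _ * _]mulrA -!exprMn !divrK.
  have [xu|[x' xE]] := padic_unit_or_dvd (x / d); last first.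
    have := unit_residue1 uu; rewrite {1}uE xE expr2 -!mulrA -mulrDr.
    by rewrite residueMr_eq0 ?residue1_natrp ?eqxx.
  have [r [_ rE]] := @padic_sqrt1Dp (((w / d) / (x / d)) ^+ 2) p_odd.
  apply: uNsq; exists (x / d * r).
  rewrite exprMn rE mulrDr mulr1 mulrCA -exprMn.
  by rewrite [x / d * _]mulrC divrK.
have [|x' xE] := sqr_dvd x (u * p%:R * d' ^+ 2 - w ^+ 2).
  by rewrite mulrBr; apply/eqP; rewrite eq_sym subr_eq -E dE; apply/eqP; ring.
have [|w' wE] := sqr_dvd w (u * d' ^+ 2 - x' ^+ 2).
  apply: (mulfI p0); apply: (addrI (x ^+ 2)); rewrite -E dE xE; ring.
have d'n : d' n != 0.
  apply: contraNneq dn => d'n.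
  by rewrite dE -add1n residueM_eq0 // residue1_natrp.
case/eqP: (IHn d' x' w' d'n).
apply: (mulfI p0); apply: (mulfI p0); move: E; rewrite dE xE wE => E.
transitivity (u * (p%:R * d') ^+ 2); first by ring.
by rewrite E; ring.
Qed.

(** If z = y s, the form is u y^2 (1 + p s^2 / u), which is u times a square. If y = p z s, it is p
    z^2 (1 + p u s^2), which is p times a square, against [padic_anisotropic]. *)
Lemma padic_norm_square (u d x y z : Zp) :
    odd p -> u \is a GRing.unit -> ~ (exists z, z ^+ 2 = u) -> d != 0 ->
    x ^+ 2 + u * y ^+ 2 + p%:R * z ^+ 2 = u * d ^+ 2 ->
  exists2 t, t != 0 & u * y ^+ 2 + p%:R * z ^+ 2 = u * t ^+ 2.
Proof.
move=> p_odd uu uNsq d0 E.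
have anis := fun w => @padic_anisotropic u d x w p_odd uu uNsq.
have yz : (exists s, z = y * s) \/ (exists s, y = p%:R * z * s).
  have [->|y0] := eqVneq y 0; last exact: padic_dvd_total.
  by right; exists 0; rewrite mulr0.
case: yz => -[s sE].
  have [r [ru rE]] := @padic_sqrt1Dp (s ^+ 2 / u) p_odd.
  have tE : u * y ^+ 2 + p%:R * z ^+ 2 = u * (y * r) ^+ 2.
    rewrite exprMn rE sE mulrDr mulrDr mulr1; congr (_ + _).
    have -> : u * (y ^+ 2 * (p%:R * (s ^+ 2 / u)))
            = p%:R * y ^+ 2 * (s ^+ 2 / u * u) by ring.
    by rewrite divrK // exprMn mulrA.
  (* If y r were 0, then u d^2 = x^2, which anisotropy with w = 0 excludes. *)
  exists (y * r) => //; apply: contraNneq d0 => yr0.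
  rewrite (anis 0) //; rewrite -E -addrA tE yr0; ring.
have [r [_ rE]] := @padic_sqrt1Dp (u * s ^+ 2) p_odd.
case/eqP: d0; apply: (anis (z * r)).
by rewrite exprMn rE -E sE; ring.
Qed.

End PadicIntegers.


(** * Fractions over an integral domain *)

Lemma fracP (R : idomainType) (x : {fraction R}) :
  exists n d : R, d != 0 /\ x = n%:F / d%:F.
Proof.
elim/quotW: x => r; have d0 := denom_ratioP r.
exists (frac r).1, (frac r).2; split=> //.
have dF0 : (frac r).2%:F != 0 by rewrite tofrac_eq0.
apply: (canRL (mulfK dF0)).
rewrite /FracField.tofrac; unlock.
rewrite -[LHS]FracField.pi_mul /FracField.mulf.
apply/eqmodP.
rewrite /= FracField.equivfE !numden_Ratio ?mulf_neq0 ?oner_eq0 //.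
by rewrite !mulr1 mulrC.
Qed.

Lemma frac_common_denom (R : idomainType) (x y z : {fraction R}) :
  exists a b c d : R,
    d != 0 /\ [/\ x = a%:F / d%:F, y = b%:F / d%:F & z = c%:F / d%:F].
Proof.
have [a [d [d0 ->]]] := fracP x.
have [b [e [e0 ->]]] := fracP y.
have [c [f [f0 ->]]] := fracP z.
exists (a * (e * f)), (b * (d * f)), (c * (d * e)), (d * (e * f)).
rewrite !mulf_neq0 //; split=> //; rewrite !tofracM.
have simplr (K : fieldType) (k l m : K) : m != 0 -> k / l = k * m / (l * m).
  by move=> m0; rewrite -mulf_div divff // mulr1.
split; first by apply: simplr; rewrite mulf_neq0 ?tofrac_eq0.
  rewrite [d%:F * (e%:F * _)]mulrCA; apply: simplr.
  by rewrite mulf_neq0 ?tofrac_eq0.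
rewrite [d%:F * (e%:F * _)]mulrA [_ * f%:F]mulrC; apply: simplr.
by rewrite mulf_neq0 ?tofrac_eq0.
Qed.

Lemma sum2_div (K : fieldType) (k l m n d : K) :
  k * (l / d) ^+ 2 + m * (n / d) ^+ 2 = (k * l ^+ 2 + m * n ^+ 2) / d ^+ 2.
Proof. by rewrite !expr_div_n !mulrA -mulrDl. Qed.

(** * Explicit formulas for 3 by 3 matrices *)

Lemma matrix3P (R : Type) (A B : 'M[R]_3) :
  [/\ A 0 0 = B 0 0, A 0 1 = B 0 1 & A 0 2 = B 0 2] ->
  [/\ A 1 0 = B 1 0, A 1 1 = B 1 1 & A 1 2 = B 1 2] ->
  [/\ A 2 0 = B 2 0, A 2 1 = B 2 1 & A 2 2 = B 2 2] -> A = B.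
Proof.
have ord3 (i : 'I_3) : [\/ i = 0, i = 1 | i = 2].
  by case: i => [[|[|[|//]]]] i3;
    [apply: Or31|apply: Or32|apply: Or33]; apply: val_inj.
move=> [? ? ?] [? ? ?] [? ? ?]; apply/matrixP => i j.
by case: (ord3 i) => ->; case: (ord3 j) => ->.
Qed.

Lemma sum3 (R : nmodType) (f : 'I_3 -> R) : \sum_i f i = f 0 + f 1 + f 2.
Proof.
rewrite !big_ord_recr big_ord0 /= add0r.
by congr (f _ + f _ + f _); apply: val_inj.
Qed.

Lemma det3 (R : comNzRingType) (A : 'M[R]_3) :
  \det A = A 0 0 * (A 1 1 * A 2 2 - A 1 2 * A 2 1)
         - A 0 1 * (A 1 0 * A 2 2 - A 1 2 * A 2 0)
         + A 0 2 * (A 1 0 * A 2 1 - A 1 1 * A 2 0).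
Proof.
rewrite (expand_det_row _ 0) sum3 /cofactor !(expand_det_row _ 0).
rewrite !big_ord_recl !big_ord0.
rewrite /cofactor !det_mx11 !mxE /=.
(* The expansion produces the same index in different forms; natural-number indices let them compute
   to a common one. *)
pose a i j := A (inord i) (inord j).
have AE i j : A i j = a i j by rewrite /a !inord_val.
by rewrite !AE /= /bump /=; ring.
Qed.

(** * Rotations about the first and third axes, parametrized by the image of e_2 *)

Section Rotations.
Context (F : fieldType) (v q : F) (v0 : v != 0).
Local Notation A := (diag_mx (\row_(j < 3) [:: 1; - v; q]`_j)).
Implicit Types (a b : F).

(** The lower block is multiplication by a + b s, where s^2 = q / v, in the basis 1, s; it sends e_2
    to (0, a, b). Norm 1 for this element means that the image has the same value of the form as
    e_2. *)
Definition rot_x a b : 'M[F]_3 :=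
  \matrix_(i, j)
    (nth [::] [:: [:: 1; 0; 0]; [:: 0; a; q * b / v]; [:: 0; b; a]] i)`_j.

(** The upper block is multiplication by a + (b / v) s, where s^2 = v, in the basis 1, s; it sends
    e_2 to (b, a, 0). *)
Definition rot_z a b : 'M[F]_3 :=
  \matrix_(i, j)
    (nth [::] [:: [:: a; b; 0]; [:: b / v; a; 0]; [:: 0; 0; 1]] i)`_j.

Lemma rot_x_form a b : - v * a ^+ 2 + q * b ^+ 2 = - v ->
  (rot_x a b)^T *m A *m rot_x a b = A.
Proof.
move=> E; have E' : a ^+ 2 = 1 + q * b ^+ 2 / v.
  apply: (mulfI v0); apply: oppr_inj.
  by rewrite -mulNr mulrDr opprD mulr1 -{2}E; field.
rewrite mul_mx_diag; apply: matrix3P; split; rewrite mxE sum3 !mxE /=.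
all: try by ring.
all: try by field.
- by rewrite -[RHS]E; ring.
- transitivity (q * (a ^+ 2 - q * b ^+ 2 / v)); first by field.
  by rewrite E'; ring.
Qed.

Lemma det_rot_x a b : - v * a ^+ 2 + q * b ^+ 2 = - v -> \det (rot_x a b) = 1.
Proof.
move=> E; rewrite det3 !mxE /=.
transitivity (- (- v * a ^+ 2 + q * b ^+ 2) / v); first by field.
by rewrite E opprK divff.
Qed.

Lemma rot_z_form a b : b ^+ 2 - v * a ^+ 2 = - v ->
  (rot_z a b)^T *m A *m rot_z a b = A.
Proof.
move=> E; rewrite mul_mx_diag; apply: matrix3P; split; rewrite mxE sum3 !mxE /=.
all: try by ring.
all: try by field.
- transitivity (- (b ^+ 2 - v * a ^+ 2) / v); first by field.
  by rewrite E opprK divff.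
- by rewrite -[RHS]E; ring.
Qed.

Lemma det_rot_z a b : b ^+ 2 - v * a ^+ 2 = - v -> \det (rot_z a b) = 1.
Proof.
move=> E; rewrite det3 !mxE /=.
transitivity (- (b ^+ 2 - v * a ^+ 2) / v); first by field.
by rewrite E opprK divff.
Qed.

Lemma rot_x_fix a b : rot_x a b *m delta_mx 0 0 = delta_mx 0 0 :> 'cV_3.
Proof.
apply/colP => i; rewrite mxE sum3 !mxE /=.
by case: i => [[|[|[|//]]]] i3 /=; ring.
Qed.

Lemma rot_z_fix a b : rot_z a b *m delta_mx 2 0 = delta_mx 2 0 :> 'cV_3.
Proof.
apply/colP => i; rewrite mxE sum3 !mxE /=.
by case: i => [[|[|[|//]]]] i3 /=; ring.
Qed.

(** [rot_z t x] sends e_2 to (x, t, 0); then [rot_x (y / t) (z / t)] keeps x and sends t e_2 to (0,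
    y, z). *)
Lemma rot_x_rot_zE x y z t i : t != 0 ->
  (rot_x (y / t) (z / t) *m rot_z t x *m delta_mx 1 0 : 'cV_3) i 0
    = [:: x; y; z]`_i.
Proof.
move=> t0; rewrite -mulmxA mxE sum3 ![(rot_z _ _ *m _) _ _]mxE !sum3 !mxE /=.
by case: i => [[|[|[|//]]]] i3 /=; field; rewrite ?v0 ?t0.
Qed.
End Rotations.

(** * The group SO(3)_p and the first decomposition *)

Section SpecialOrthogonal.
Context (p : nat) (p_pr : prime p).
Local Notation Qp := (padic p_pr).
Implicit Types (v : Qp) (L : 'M[Qp]_3).

Lemma SO3_mul v L1 L2 : SO3 v L1 -> SO3 v L2 -> SO3 v (L1 *m L2).
Proof.
move=> [L1A L1d] [L2A L2d]; split; last by rewrite det_mulmx L1d L2d mulr1.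
by rewrite trmx_mul -2!mulmxA [L1^T *m _]mulmxA (mulmxA _ L1) L1A mulmxA.
Qed.

Lemma SO3_unitmx v L : SO3 v L -> L \in unitmx.
Proof. by case=> _ Ld; rewrite unitmxE Ld unitr1. Qed.

Lemma SO3_inv v L : SO3 v L -> SO3 v (invmx L).
Proof.
move=> LSO; have Lu := SO3_unitmx LSO; case: LSO => LA Ld.
split; last by rewrite det_inv Ld invr1.
rewrite -{1}LA trmx_inv !mulmxA mulVmx ?unitmx_tr // mul1mx.
by rewrite -mulmxA mulmxV // mulmx1.
Qed.

Lemma stab_inv v i L : stab v i L -> stab v i (invmx L).
Proof.
move=> [LSO Le]; split; first exact: SO3_inv.
by rewrite -{1}Le mulKmx // (SO3_unitmx LSO).
Qed.

Lemma Qplus_SO3 v L x : SO3 v L -> Qplus v (L *m x) = Qplus v x.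
Proof. by move=> [LA _]; rewrite -!Qplus_mxE trmx_mul -{2}LA !mulmxA. Qed.

Lemma rot_x_stab v a b :
  v != 0 -> - v * a ^+ 2 + p%:R * b ^+ 2 = - v -> G_x v (rot_x v p%:R a b).
Proof.
move=> v0 E; split; last exact: rot_x_fix.
by split; [exact: rot_x_form | exact: det_rot_x].
Qed.

Lemma rot_z_stab v a b :
  v != 0 -> b ^+ 2 - v * a ^+ 2 = - v -> G_z v (rot_z v a b).
Proof.
move=> v0 E; split; last exact: rot_z_fix.
by split; [exact: rot_z_form | exact: det_rot_z].
Qed.

(** Over a common denominator d the equation becomes integral with right-hand side u d^2, the shape
    required by [padic_norm_square]. *)
Lemma padic_frac_norm_square (u : padic_int p_pr) (x y z : Qp) :
    odd p -> u \is a GRing.unit -> ~ (exists w, w ^+ 2 = u) ->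
    x ^+ 2 + u%:F * y ^+ 2 + p%:R * z ^+ 2 = u%:F ->
  exists2 t, t != 0 & u%:F * y ^+ 2 + p%:R * z ^+ 2 = u%:F * t ^+ 2.
Proof.
have [a [b [c [d [d0 [-> -> ->]]]]]] := frac_common_denom x y z.
move=> p_odd uu uNsq.
have dF0 : d%:F ^+ 2 != 0 by rewrite expf_neq0 ?tofrac_eq0.
have pF : p%:R = (p%:R : padic_int p_pr)%:F by rewrite rmorph_nat.
have tofracE (k l m n : padic_int p_pr) :
    (k * l ^+ 2 + m * n ^+ 2)%:F = k%:F * l%:F ^+ 2 + m%:F * n%:F ^+ 2.
  by rewrite tofracD !(tofracXn, tofracM).
rewrite -addrA pF sum2_div -tofracE.
rewrite expr_div_n -mulrDl -tofracXn -tofracD => /(canRL (divfK dF0)).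
rewrite -tofracXn -tofracM => /eqP; rewrite tofrac_eq addrA => /eqP.
move=> /(padic_norm_square p_odd uu uNsq d0) [t t0 tE].
exists (t%:F / d%:F); first by rewrite mulf_neq0 ?invr_eq0 ?tofrac_eq0.
by rewrite tE tofracM !tofracXn expr_div_n [RHS]mulrA.
Qed.

Lemma cardan_xzy (u : padic_int p_pr) v M :
    odd p -> u \is a GRing.unit -> ~ (exists w : Qp, w ^+ 2 = u%:F) ->
    v = - u%:F -> SO3 v M ->
  exists Rx Rz Ry, [/\ G_x v Rx, G_z v Rz, G_y v Ry & M = Rx *m Rz *m Ry].
Proof.
move=> p_odd uu uNsq vE MSO.
have vN0 : v != 0.
  rewrite vE oppr_eq0 tofrac_eq0.
  by apply: contraTneq uu => ->; rewrite unitr0.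
set e : 'cV[Qp]_3 := delta_mx 1 0.
have [x [y [z wE]]] : exists x y z, forall i, (M *m e) i 0 = [:: x; y; z]`_i.
  exists ((M *m e) 0 0), ((M *m e) 1 0), ((M *m e) 2 0).
  by case=> [[|[|[|//]]]] i3 /=; congr (_ _ 0); apply: val_inj.
(* Q_+(M e_2) = Q_+(e_2) = -v = u. *)
have normE : x ^+ 2 + u%:F * y ^+ 2 + p%:R * z ^+ 2 = u%:F.
  have := Qplus_SO3 e MSO; rewrite /Qplus !wE !mxE /= vE => E.
  transitivity (x ^+ 2 - - u%:F * y ^+ 2 + p%:R * z ^+ 2); first by ring.
  by rewrite E; ring.
have [|t t0 tE] := padic_frac_norm_square p_odd uu _ normE.
  by case=> w wu; apply: uNsq; exists w%:F; rewrite -wu tofracXn.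
(* The norm condition reads (u y^2 + p z^2) / t^2 = u, which is the choice of t. *)
have RxG : G_x v (rot_x v p%:R (y / t) (z / t)).
  by apply: rot_x_stab => //; rewrite vE opprK sum2_div tE mulfK ?expf_neq0.
(* The norm condition reads x^2 + u t^2 = u. *)
have RzG : G_z v (rot_z v t x).
  apply: rot_z_stab => //; rewrite vE opprK.
  by rewrite mulNr opprK -tE addrA.
set Rx := rot_x _ _ _ _ in RxG; set Rz := rot_z _ _ _ in RzG.
have RSO : SO3 v (Rx *m Rz) by apply: SO3_mul; [case: RxG | case: RzG].
have RU := SO3_unitmx RSO.
(* The third factor is forced by the other two; it fixes e_2 because [Rx *m Rz] and [M] agree on
   e_2. *)
exists Rx, Rz, (invmx (Rx *m Rz) *m M); split=> //; last by rewrite mulKVmx.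
split; first by apply: SO3_mul => //; apply: SO3_inv.
rewrite -mulmxA; apply: (canLR (mulKmx RU)).
apply/colP => i; rewrite wE; apply/esym.
exact: (rot_x_rot_zE p%:R vN0 x y z i t0).
Qed.

End SpecialOrthogonal.

Theorem theorem10 (p : nat) (p_pr : prime p) (p_mod4 : (p = 1 %[mod 4])%N)
    (u : padic_int p_pr) (u_unit : u \is a GRing.unit)
    (u_nonsquare : ~ exists w : padic p_pr, w ^+ 2 = u%:F)
    (v : padic p_pr) (v_def : v = - u%:F)
    (M : 'M[padic p_pr]_3) (M_SO3 : SO3 v M) :
  (exists Rx Rz Ry : 'M[padic p_pr]_3,
     [/\ G_x v Rx, G_z v Rz, G_y v Ry & M = Rx *m Rz *m Ry]) /\
  (exists Ry Rz Rx : 'M[padic p_pr]_3,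
     [/\ G_y v Ry, G_z v Rz, G_x v Rx & M = Ry *m Rz *m Rx]).
Proof.
have p_odd : odd p by rewrite -[odd p](@odd_mod p 4) // p_mod4.
split; first exact: cardan_xzy p_odd u_unit u_nonsquare v_def M_SO3.
have [Rx [Rz [Ry [RxG RzG RyG E]]]] :=
  cardan_xzy p_odd u_unit u_nonsquare v_def (SO3_inv M_SO3).
have unit i R : stab v i R -> R \in unitmx by case=> /SO3_unitmx.
exists (invmx Ry), (invmx Rz), (invmx Rx); split; try exact: stab_inv.
(* Moving the inverses across one at a time leaves M (Rx Rz Ry) = 1, where the product in
   parentheses is the inverse of M. *)
do 2![apply: (canRL (mulmxK (unit _ _ _))); first by eassumption].
rewrite -[RHS]mul1mx; apply: (canRL (mulmxK (unit _ _ RyG))).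
by rewrite /= -[M *m _ *m _]mulmxA -mulmxA -E mulmxV // (SO3_unitmx M_SO3).
Qed.
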